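(* Let $a_1,a_2,a_3,a_4,p_2,p_3,p_4,x_1,x_2,q_1,q_2,q_3,q_4$ be nonzero complex numbers, set $p_1:=(q_1q_2q_4/q_3)^{1/2}$, $L:=(p_1p_2p_3p_4)^{1/2}$, $L_0:=(q_1q_2q_3q_4)^{1/2}$, $X:=a_4/a_3$. Then for every integer $n\ge0$ (whenever no denominator vanishes) $$\sum_{k=0}^{n-1}\big((p_2p_4/p_3)^{(k-1)/2}a_2X-p_1^{(k-1)/2}a_1\big)\big((p_2p_3/p_4)^{(k-1)/2}a_2/X-p_1^{(k-1)/2}a_1\big)$$ $$\qquad\times\frac{(a_2^2/p_2;p_2)_k(x_1^2;q_1)_k(x_2^2;q_2)_k}{(a_1a_2p_3X/L;L/p_3)_{k+1}(a_1a_2p_4/(XL);L/p_4)_{k+1}(x_1^2x_2^2p_1/a_1^2;L_0/q_4)_k}$$ $$=1-\frac{(a_2^2/p_2;p_2)_n(x_1^2;q_1)_n(x_2^2;q_2)_n}{(a_1a_2p_3X/L;L/p_3)_n(a_1a_2p_4/(XL);L/p_4)_n(x_1^2x_2^2p_1/a_1^2;L_0/q_4)_n}$$ $$-\frac{1-a_2^2/p_2}{1-x_1^2x_2^2p_1/a_1^2}\sum_{k=0}^{n-1}\big((q_1q_4/q_3)^{k/2}-q_2^{k/2}p_1x_2^2/a_1^2\big)\big((q_1q_3/q_4)^{k/2}x_1^2-q_2^{k/2}a_1^2/p_1\big)$$ $$\qquad\times\frac{(a_2^2;p_2)_k(x_1^2;q_1)_k(x_2^2;q_2)_k}{(a_1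a_2p_3X/L;L/p_3)_{k+1}(a_1a_2p_4/(XL);L/p_4)_{k+1}(x_1^2x_2^2p_1L_0/(q_4a_1^2);L_0/q_4)_k}.$$
   Context: For a complex number $z$, a nonzero complex base $p$ and an integer $k\ge0$, $(z;p)_k:=\prod_{j=0}^{k-1}(1-zp^j)$. Square roots $p_i^{1/2}$ ($i=2,3,4$) and $q_i^{1/2}$ are fixed, $p_1^{1/2}$ denotes a fixed square root of $p_1$, and all half-integer powers of products/quotients of the $p_i$ (resp. $q_i$) are understood as the corresponding products of powers of these fixed roots. *)

(* Defs.v *)
From HB Require Import structures.
From mathcomp Require Import all_boot all_order all_algebra.
From mathcomp.real_closed Require Import complex.
From mathcomp Require Import reals.

Set Implicit Arguments.
Unset Strict Implicit.
Unset Printing Implicit Defensive.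

Import Order.TTheory GRing.Theory Num.Theory.
Local Open Scope ring_scope.

Definition qpoch (F : comNzRingType) (z p : F) (k : nat) : F :=
  \prod_(0 <= j < k) (1 - z * p ^+ j).

(* Main.v *)
Require Import Defs.
From HB Require Import structures.
From mathcomp Require Import all_boot all_order all_algebra.
From mathcomp.real_closed Require Import complex.
From mathcomp Require Import reals.
From mathcomp Require Import ring.

Set Implicit Arguments.
Unset Strict Implicit.
Unset Printing Implicit Defensive.

Import Order.TTheory GRing.Theory Num.Theory.
Local Open Scope ring_scope.

(** Put [u k = a2^2 p2^(k-1)], [v k = a1^2 p1^(k-1)], [x k = x1^2 q1^k],
    [y k = x2^2 q2^k], and let [1 - b k], [1 - c k], [1 - d k] be the [k]-th
    factors of the three denominators.  Then [b k * c k = u k * v k] and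
    [d k * v k = x k * y k], whence
      [(1-b)(1-c)(1-d) - (1-u)(1-x)(1-y)
         = (u + v - b - c)(1-d) + (1-u)(x + y - v - d)].
    Dividing by the denominators, the left-hand side telescopes, while the two
    terms on the right are the summands of the two sums. *)

Lemma prod1B_neq0_leq (F : fieldType) (f : nat -> F) (m n : nat) :
  (m <= n)%N -> \prod_(0 <= j < n) (1 - f j) != 0 ->
  \prod_(0 <= j < m) (1 - f j) != 0.
Proof.
move=> le_mn; rewrite (big_cat_nat (leq0n m) le_mn) /= mulf_eq0 negb_or.
by case/andP.
Qed.

Lemma telescoping_sum (F : fieldType) (b c d u v x y : nat -> F) (n : nat) :
  let P f k := \prod_(0 <= j < k) (1 - f j) in
  (forall k, b k * c k = u k * v k) -> (forall k, d k * v k = x k * y k) ->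
  P b n != 0 -> P c n != 0 -> P d n != 0 ->
  \sum_(0 <= k < n) (u k + v k - b k - c k)
      * (P u k * P x k * P y k / (P b k.+1 * P c k.+1 * P d k))
  = 1 - P u n * P x n * P y n / (P b n * P c n * P d n)
    - \sum_(0 <= k < n) (x k + y k - v k - d k)
      * (P u k.+1 * P x k * P y k / (P b k.+1 * P c k.+1 * P d k.+1)).
Proof.
move=> P bcE dvE; elim: n => [|n IHn] Pb Pc Pd.
  by rewrite !big_geq // /P !big_geq // !mul1r invr1 subrr subr0.
have PS f k : P f k.+1 = P f k * (1 - f k) by rewrite /P big_nat_recr /=.
rewrite !(big_nat_recr n) //= IHn; try exact: prod1B_neq0_leq (leqnSn n) _.
move: Pb Pc Pd; rewrite !PS !mulf_eq0 !negb_or.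
move=> /andP[Pb bn] /andP[Pc cn] /andP[Pd dn].
(* By the relations, [(1-b)(1-c) = (1-u)(1-v) + (u+v-b-c)] and
   [(1-x)(1-y) = (1-v)(1-d) - (x+y-v-d)]; the common term [(1-u)(1-v)(1-d)] cancels. *)
have key : (1 - b n) * (1 - c n) * (1 - d n) - (1 - u n) * (1 - x n) * (1 - y n)
    = (u n + v n - b n - c n) * (1 - d n) + (1 - u n) * (x n + y n - v n - d n).
  by ring: (bcE n) (dvE n).
(* Once [key] is solved for this factor, what remains is an identity of rational functions in
   independent variables, as [field] requires. *)
have -> : (u n + v n - b n - c n)
    = ((1 - b n) * (1 - c n) * (1 - d n) - (1 - u n) * (1 - x n) * (1 - y n)
       - (1 - u n) * (x n + y n - v n - d n)) / (1 - d n).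
  by rewrite key addrK mulfK.
by field; rewrite Pb Pc Pd bn cn dn.
Qed.

(** Peeling off first factors produces the constant in front of the second sum and shifts the bases
    of its factorials. *)
Lemma qpochSl (F : comNzRingType) (z p : F) (k : nat) :
  qpoch z p k.+1 = (1 - z) * qpoch (z * p) p k.
Proof.
rewrite /qpoch big_nat_recl // expr0 mulr1; congr (_ * _).
by apply: eq_bigr => j _; rewrite exprS mulrA.
Qed.

(* [sp_i], [sq_i] are the fixed square roots of [p_i], [q_i]; every
   half-integer power is written as the matching integer power of a
   product/quotient of these roots. *)
Theorem theorem3p1 (R : realType)
  (a1 a2 a3 a4 p2 p3 p4 x1 x2 q1 q2 q3 q4 : R[i])
  (sp1 sp2 sp3 sp4 sq1 sq2 sq3 sq4 : R[i])
  (ha1 : a1 != 0) (ha2 : a2 != 0) (ha3 : a3 != 0) (ha4 : a4 != 0)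
  (hp2 : p2 != 0) (hp3 : p3 != 0) (hp4 : p4 != 0)
  (hx1 : x1 != 0) (hx2 : x2 != 0)
  (hq1 : q1 != 0) (hq2 : q2 != 0) (hq3 : q3 != 0) (hq4 : q4 != 0)
  (hsp2 : sp2 ^+ 2 = p2) (hsp3 : sp3 ^+ 2 = p3) (hsp4 : sp4 ^+ 2 = p4)
  (hsq1 : sq1 ^+ 2 = q1) (hsq2 : sq2 ^+ 2 = q2)
  (hsq3 : sq3 ^+ 2 = q3) (hsq4 : sq4 ^+ 2 = q4) :
  let p1 := sq1 * sq2 * sq4 / sq3 in
  let L := sp1 * sp2 * sp3 * sp4 in
  let L0 := sq1 * sq2 * sq3 * sq4 in
  let X := a4 / a3 in
  sp1 ^+ 2 = p1 ->
  forall n : nat,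
  (* no denominator vanishes *)
  (forall k : nat, (k < n)%N ->
     [/\ qpoch (a1 * a2 * p3 * X / L) (L / p3) k.+1 != 0,
         qpoch (a1 * a2 * p4 / (X * L)) (L / p4) k.+1 != 0,
         qpoch (x1 ^+ 2 * x2 ^+ 2 * p1 / a1 ^+ 2) (L0 / q4) k != 0
       & qpoch (x1 ^+ 2 * x2 ^+ 2 * p1 * L0 / (q4 * a1 ^+ 2)) (L0 / q4) k
           != 0]) ->
  qpoch (a1 * a2 * p3 * X / L) (L / p3) n != 0 ->
  qpoch (a1 * a2 * p4 / (X * L)) (L / p4) n != 0 ->
  qpoch (x1 ^+ 2 * x2 ^+ 2 * p1 / a1 ^+ 2) (L0 / q4) n != 0 ->
  1 - x1 ^+ 2 * x2 ^+ 2 * p1 / a1 ^+ 2 != 0 ->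
  \sum_(0 <= k < n)
     ((sp2 * sp4 / sp3) ^ (k%:Z - 1) * a2 * X - sp1 ^ (k%:Z - 1) * a1)
   * ((sp2 * sp3 / sp4) ^ (k%:Z - 1) * a2 / X - sp1 ^ (k%:Z - 1) * a1)
   * (qpoch (a2 ^+ 2 / p2) p2 k * qpoch (x1 ^+ 2) q1 k * qpoch (x2 ^+ 2) q2 k
      / (qpoch (a1 * a2 * p3 * X / L) (L / p3) k.+1
         * qpoch (a1 * a2 * p4 / (X * L)) (L / p4) k.+1
         * qpoch (x1 ^+ 2 * x2 ^+ 2 * p1 / a1 ^+ 2) (L0 / q4) k))
  = 1
  - qpoch (a2 ^+ 2 / p2) p2 n * qpoch (x1 ^+ 2) q1 n * qpoch (x2 ^+ 2) q2 n
      / (qpoch (a1 * a2 * p3 * X / L) (L / p3) n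
         * qpoch (a1 * a2 * p4 / (X * L)) (L / p4) n
         * qpoch (x1 ^+ 2 * x2 ^+ 2 * p1 / a1 ^+ 2) (L0 / q4) n)
  - (1 - a2 ^+ 2 / p2) / (1 - x1 ^+ 2 * x2 ^+ 2 * p1 / a1 ^+ 2)
    * \sum_(0 <= k < n)
       ((sq1 * sq4 / sq3) ^+ k - sq2 ^+ k * p1 * x2 ^+ 2 / a1 ^+ 2)
     * ((sq1 * sq3 / sq4) ^+ k * x1 ^+ 2 - sq2 ^+ k * a1 ^+ 2 / p1)
     * (qpoch (a2 ^+ 2) p2 k * qpoch (x1 ^+ 2) q1 k * qpoch (x2 ^+ 2) q2 k
        / (qpoch (a1 * a2 * p3 * X / L) (L / p3) k.+1
           * qpoch (a1 * a2 * p4 / (X * L)) (L / p4) k.+1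
           * qpoch (x1 ^+ 2 * x2 ^+ 2 * p1 * L0 / (q4 * a1 ^+ 2)) (L0 / q4) k)).
Proof.
move=> p1 L L0 X sp1E n _ Bn Cn Dn d0.
have Np (p r : R[i]) : r ^+ 2 = p -> p != 0 -> r != 0.
  by move=> <-; rewrite expf_eq0.
have sp2N := Np _ _ hsp2 hp2; have sp3N := Np _ _ hsp3 hp3.
have sp4N := Np _ _ hsp4 hp4; have sq1N := Np _ _ hsq1 hq1.
have sq2N := Np _ _ hsq2 hq2; have sq3N := Np _ _ hsq3 hq3.
have sq4N := Np _ _ hsq4 hq4.
have p1N : p1 != 0 by rewrite !mulf_neq0 ?invr_eq0.
have sp1N := Np _ _ sp1E p1N.
have XN : X != 0 by rewrite mulf_neq0 ?invr_eq0.
clearbody X; subst p2 p3 p4 q1 q2 q3 q4.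
have zpowB1 (r : R[i]) (k : nat) : r != 0 -> r ^ (k%:Z - 1) = r ^+ k / r.
  by move=> rN; rewrite expfzDr // -exprnP expr1z.
pose b k := a1 * a2 * sp3 ^+ 2 * X / L * (L / sp3 ^+ 2) ^+ k.
pose c k := a1 * a2 * sp4 ^+ 2 / (X * L) * (L / sp4 ^+ 2) ^+ k.
pose d k := x1 ^+ 2 * x2 ^+ 2 * p1 / a1 ^+ 2 * (L0 / sq4 ^+ 2) ^+ k.
pose u k := a2 ^+ 2 / sp2 ^+ 2 * (sp2 ^+ 2) ^+ k.
(* No factorial belongs to [v]: it is forced by [b k * c k = u k * v k], since [L ^+ 2] is the
   product of the four [p_i]. *)
pose v k := a1 ^+ 2 / p1 * p1 ^+ k.
pose x k := x1 ^+ 2 * (sq1 ^+ 2) ^+ k.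
pose y k := x2 ^+ 2 * (sq2 ^+ 2) ^+ k.
have bcE k : b k * c k = u k * v k.
  (* [p1] becomes a square here to match the roots in [L]; in [dvE] it is expanded in the roots
     [sq_i] to match [L0]. *)
  rewrite /b /c /u /v -sp1E /L !(exprMn, exprVn).
  by field; rewrite ?expf_neq0 // sp1N sp2N sp3N sp4N XN.
have dvE k : d k * v k = x k * y k.
  rewrite /d /v /x /y /p1 /L0 !(exprMn, exprVn).
  by field; rewrite ?expf_neq0 // ha1 sq1N sq2N sq3N sq4N.
have := telescoping_sum bcE dvE Bn Cn Dn; rewrite /= => tele.
rewrite mulr_sumr; etransitivity; [etransitivity; [|exact: tele]|congr (_ - _)].
  (* The summand has the form [(s - t)(r - t)] with [s r = u], [t^2 = v], [s t = b], [r t = c]. *)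
  apply: eq_bigr => k _; congr (_ * _).
  rewrite !zpowB1 ?mulf_neq0 ?invr_eq0 //.
  rewrite /u /v /b /c -sp1E /L !(exprMn, exprVn).
  by field; rewrite ?expf_neq0 // sp1N sp2N sp3N sp4N XN.
apply: eq_bigr => k _.
have -> : \prod_(0 <= j < k.+1) (1 - u j)
    = (1 - a2 ^+ 2 / sp2 ^+ 2) * qpoch (a2 ^+ 2) (sp2 ^+ 2) k.
  by rewrite -[LHS]/(qpoch _ _ _) qpochSl divfK.
have -> : \prod_(0 <= j < k.+1) (1 - d j)
    = (1 - x1 ^+ 2 * x2 ^+ 2 * p1 / a1 ^+ 2)
      * qpoch (x1 ^+ 2 * x2 ^+ 2 * p1 * L0 / (sq4 ^+ 2 * a1 ^+ 2))
          (L0 / sq4 ^+ 2) k.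
  rewrite -[LHS]/(qpoch _ _ _) qpochSl; congr (_ * qpoch _ _ _).
  by rewrite mulf_div [_ * sq4 ^+ 2]mulrC.
(* On the right, the outer products of the two binomials give [x] and [y], the cross products [v]
   and [d]. *)
have -> : x k + y k - v k - d k
    = ((sq1 * sq4 / sq3) ^+ k - sq2 ^+ k * p1 * x2 ^+ 2 / a1 ^+ 2)
      * ((sq1 * sq3 / sq4) ^+ k * x1 ^+ 2 - sq2 ^+ k * a1 ^+ 2 / p1).
  rewrite /x /y /v /d /L0 /p1 !(exprMn, exprVn).
  by field; rewrite ?expf_neq0 // ha1 sq1N sq2N sq3N sq4N.
rewrite -!/(qpoch _ _ _) !invfM.
by ring.
Qed.
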